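(* For all integers $k\ge 0$ and $0\le v\le n$ and every real $x$, $$B_k^n(x)=\sum_{j=0}^{v}B_j^v(x)\,B_{k-j}^{n-v}(x),$$ where $B_k^n$ denotes the Bernstein basis function.
   Context: The Bernstein basis functions are $B_k^n(x)=\binom{n}{k}x^k(1-x)^{n-k}$ for integers $0\le k\le n$, with the convention that $B_k^n(x)=0$ when $k<0$ or $k>n$ (and $0^0=1$). *)

(* Defs.v *)
From mathcomp Require Import all_boot all_order all_algebra reals.

Set Implicit Arguments.
Unset Strict Implicit.
Unset Printing Implicit Defensive.

Import Order.TTheory GRing.Theory Num.Theory.
Local Open Scope ring_scope.

(* The lower index is an integer so that negative indices really occur (nat
   subtraction would truncate k - j to 0); `|k| only reads off the natural
   number k inside the guard.  The convention 0^0 = 1 is x ^+ 0 = 1. *)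
Definition bernstein (R : realType) (n : nat) (k : int) (x : R) : R :=
  if (0 <= k) && (k <= n%:Z) then
    'C(n, `|k|%N)%:R * x ^+ `|k|%N * (1 - x) ^+ (n - `|k|%N)
  else 0.

(* Main.v *)
Require Import Defs.
From mathcomp Require Import all_boot all_order all_algebra reals.

Import Order.TTheory GRing.Theory Num.Theory.
Local Open Scope ring_scope.

(** The Bernstein values [B_k^n(x)] are the coefficients of the polynomial
    [(1 - x + x X)^n] in [X]; the theorem compares the coefficients of [X^k] in
    [(1 - x + x X)^n = (1 - x + x X)^v (1 - x + x X)^(n - v)]. *)

Lemma bernstein_nat (R : realType) (n k : nat) (x : R) :
  bernstein n k%:Z x = 'C(n, k)%:R * x ^+ k * (1 - x) ^+ (n - k).
Proof.
rewrite /bernstein lez_nat /=; case: leqP => // lt_nk.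
by rewrite bin_small // !mul0r.
Qed.

Lemma bernstein_neg (R : realType) (n : nat) (k : int) (x : R) :
  k < 0 -> bernstein n k x = 0.
Proof. by rewrite /bernstein ltNge => /negbTE ->. Qed.

Lemma coef_bernstein_gen (R : realType) (n k : nat) (x : R) :
  (((1 - x)%:P + x *: 'X) ^+ n)`_k = bernstein n k%:Z x.
Proof.
rewrite bernstein_nat exprDn coef_sum.
under eq_bigr => i _ do
  rewrite coefMn -polyC_exp exprZn coefCM coefZ coefXn.
have [lt_kn | le_nk] := ltnP k n.+1.
  (* The [i]-th binomial term is a multiple of ['X^i], so only [i = k] contributes. *)
  rewrite (bigD1 (Ordinal lt_kn)) //= eqxx mulr1 big1 ?addr0.
    by rewrite -[LHS]mulr_natl -mulrA (mulrC (x ^+ k)).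
  by move=> i; rewrite -val_eqE /= eq_sym => /negbTE ->; rewrite !mulr0 mul0rn.
rewrite bin_small // !mul0r big1 // => i _.
by rewrite gtn_eqF ?(leq_trans (ltn_ord i)) // !mulr0 mul0rn.
Qed.

Lemma sum_nat_trunc (V : nmodType) (F : nat -> V) (m n : nat) :
  (m <= n)%N -> (forall j, (m <= j)%N -> F j = 0) ->
  \sum_(0 <= j < n) F j = \sum_(0 <= j < m) F j.
Proof.
move=> le_mn F0; rewrite (big_cat_nat _ le_mn) //= -[RHS]addr0; congr (_ + _).
by rewrite big_nat big1 // => j /andP[/F0].
Qed.

Theorem theorem9 (R : realType) (k n v : nat) (hvn : (v <= n)%N) (x : R) :
  bernstein n k%:Z x =
  \sum_(0 <= j < v.+1)
    bernstein v j%:Z x * bernstein (n - v)%N (k%:Z - j%:Z) x.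
Proof.
pose F j := bernstein v j%:Z x * bernstein (n - v)%N (k%:Z - j%:Z) x.
(* [F] vanishes beyond [v] by its first factor and beyond [k] by the negative index of its
   second. *)
have Fv j : (v < j)%N -> F j = 0.
  by move=> lt_vj; rewrite /F bernstein_nat bin_small // !mul0r.
have Fk j : (k < j)%N -> F j = 0.
  by move=> lt_kj; rewrite /F (@bernstein_neg _ (n - v)) ?mulr0 // subr_lt0.
rewrite -coef_bernstein_gen -{1}(subnKC hvn) exprD coefM.
transitivity (\sum_(0 <= j < k.+1) F j).
  rewrite big_mkord; apply: eq_bigr => j _.
  (* Here [j <= k], so the truncated [k - j] from [coefM] agrees with the integer difference. *)
  by rewrite !coef_bernstein_gen /F subzn // -ltnS.
(* The ranges [j <= k] and [j <= v] are compared through [j <= maxn k v], which only adds zero terms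
   to either. *)
rewrite -(@sum_nat_trunc _ F k.+1 (maxn k v).+1) ?ltnS ?leq_maxl //.
by rewrite (@sum_nat_trunc _ F v.+1) ?ltnS ?leq_maxr.
Qed.
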